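(* For every integer $i\ge 7$, let $S_i:=F_{i-1}[1\ldots f_{i-1}-2]$ be the prefix of $F_{i-1}$ of length $f_{i-1}-2$. Taking $F_i$ as the text, the net frequency of $S_i$ in $F_i$ satisfies $\phi(S_i)\ge 2$.
   Context: Fibonacci words: $F_1=\texttt{b}$, $F_2=\texttt{a}$, $F_i=F_{i-1}F_{i-2}$ for $i\ge 3$; $f_i=|F_i|$. For a text $T$ of length $n$, let $f(W)$ be the number of occurrences of $W$ in $T$. An occurrence $(s,e)$, $1\le s\le e\le n$, is a net occurrence if $f(T[s\ldots e])\ge 2$, $f(T[s-1\ldots e])=1$ and $f(T[s\ldots e+1])=1$, where the second condition is considered true when $s=1$ and the third when $e=n$. The net frequency $\phi(S)$ of $S$ in $T$ is the number of net occurrences $(s,e)$ with $T[s\ldots e]=S$. *)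

(* Defs.v *)
From HB Require Import structures.
From mathcomp Require Import all_boot.

Set Implicit Arguments.
Unset Strict Implicit.
Unset Printing Implicit Defensive.

Inductive letter := La | Lb.

Definition letter_is_a (x : letter) : bool := if x is La then true else false.
Definition letter_of_bool (c : bool) : letter := if c then La else Lb.
Lemma letter_is_aK : cancel letter_is_a letter_of_bool.
Proof. by case. Qed.

HB.instance Definition _ := Equality.copy letter (can_type letter_is_aK).

(* Indexed from 1; the value at 0 is a dummy. *)
Fixpoint fibword (i : nat) : seq letter :=
  match i with
  | 0 => [::]
  | 1 => [:: Lb]
  | (k.+1 as k').+1 => if k == 0 then [:: La] else fibword k' ++ fibword k
  end.

Definition fiblen (i : nat) : nat := size (fibword i).

Section Text.

Variable (A : eqType).
Implicit Types (T W : seq A) (s e : nat).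

(* T[s..e], with 1-based inclusive endpoints. *)
Definition factor T s e : seq A := drop s.-1 (take e T).

(* All pairs (s, e) with 1 <= s <= e <= size T, each listed once. *)
Definition positions T : seq (nat * nat) :=
  [seq (s, e) | s <- iota 1 (size T), e <- iota s ((size T).+1 - s)].

Definition frequency T W : nat :=
  count (fun o => factor T o.1 o.2 == W) (positions T).

Definition net_occurrence T s e : bool :=
  [&& 1 <= s, s <= e, e <= size T,
      2 <= frequency T (factor T s e),
      (s == 1) || (frequency T (factor T s.-1 e) == 1) &
      (e == size T) || (frequency T (factor T s e.+1) == 1)].

Definition net_frequency T W : nat :=
  count (fun o => net_occurrence T o.1 o.2 && (factor T o.1 o.2 == W))
        (positions T).

End Text.

(* Main.v *)
Require Import Defs.
From mathcomp Require Import all_boot.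
From mathcomp Require Import zify.

(** Write [F_i = w v w] with [w = F_{i-2}] and [v = F_{i-3}].  The words [w v] and [v w]
    are [C x y] and [C y x] with [x <> y], so [C = S_i] occurs at offsets [0] and [|w|].
    Up to its last two letters the text is a prefix of a power of [w], and [C] starts
    with [w], so a third occurrence of [C] would make [w] equal to a proper rotation of
    itself.  This is impossible: commuting words have proportional numbers of [a]'s,
    while the length of [F_k] is coprime to its number [f_{k-1}] of [a]'s.  As the two
    occurrences of [C] are followed by different letters and the first one is a prefix
    of the text, both are net occurrences. *)

Set Implicit Arguments.
Unset Strict Implicit.
Unset Printing Implicit Defensive.

Section Occurrences.

Variable A : eqType.
Implicit Types (T W : seq A) (x : A).

(* Offsets are counted from 0: [W] occurs at [p] when [(p.+1, p + size W)] is an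
   occurrence of [W] in the 1-based convention of [factor]. *)
Definition occurs T W p : bool := prefix W (drop p T).

Definition occurrences T W : seq nat := [seq p <- iota 0 (size T) | occurs T W p].

Lemma mem_occurrences T W p : W != [::] -> (p \in occurrences T W) = occurs T W p.
Proof.
move=> W_n0; rewrite mem_filter mem_iota /= add0n andb_idr // /occurs.
by rewrite ltnNge; apply: contraL => /drop_oversize->; rewrite prefixs0.
Qed.

Lemma uniq_occurrences T W : uniq (occurrences T W).
Proof. exact/filter_uniq/iota_uniq. Qed.

Lemma occurs_size T W p : W != [::] -> occurs T W p -> p + size W <= size T.
Proof.
move=> W_n0 /size_prefix; rewrite size_drop.
by move: W_n0; rewrite -size_eq0; lia.
Qed.

Lemma occurs_catl T1 T2 W p :
  p + size W <= size T1 -> occurs (T1 ++ T2) W p = occurs T1 W p.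
Proof.
move=> pW; rewrite /occurs drop_cat; case: ltnP => [_|T1p].
  by rewrite !prefixE takel_cat // size_drop; lia.
by have /size0nil-> : size W = 0; [lia | rewrite !prefix0s].
Qed.

Lemma occurs_cons T W x p :
  occurs T (x :: W) p = (onth T p == Some x) && occurs T W p.+1.
Proof.
rewrite /occurs; elim: T p => [|y T IHT] [|p] //=.
by rewrite drop0 eq_sym (inj_eq Some_inj).
Qed.

Lemma occurs_rcons T W x p :
  occurs T (rcons W x) p = occurs T W p && (onth T (p + size W) == Some x).
Proof.
elim: W p => [|y W IHW] p.
  by rewrite occurs_cons /occurs !prefix0s andbT addn0.
by rewrite rcons_cons !occurs_cons IHW andbA addSnnS.
Qed.

Lemma mem_positions T s e :
  ((s, e) \in positions T) = [&& 1 <= s, s <= e & e <= size T].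
Proof.
apply/allpairsPdep/idP => [[s' [e' [+ + [-> ->]]]]|]; first by rewrite !mem_iota; lia.
by move=> se; exists s, e; split; rewrite ?mem_iota //; lia.
Qed.

Lemma uniq_positions T : uniq (positions T).
Proof.
apply: allpairs_uniq_dep; rewrite ?iota_uniq //.
- by move=> s _; apply: iota_uniq.
- by move=> [s e] [s' e'] _ _ [-> ->].
Qed.

Lemma factor_eq_occurs T W s e : [&& 1 <= s, s <= e & e <= size T] ->
  (factor T s e == W) = occurs T W s.-1 && (e == s.-1 + size W).
Proof.
move=> se; rewrite /occurs prefixE take_drop addnC.
have [->|neq_e] := eqVneq e; first by rewrite andbT.
rewrite andbF; apply: contra_neqF neq_e => /eqP <-.
by rewrite size_drop size_takel; lia.
Qed.

Lemma factor_occurs T W p :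
  W != [::] -> occurs T W p -> factor T p.+1 (p + size W) = W.
Proof.
move=> W_n0 Wp; have := occurs_size W_n0 Wp; rewrite -size_eq0 in W_n0 => pW.
by apply/eqP; rewrite factor_eq_occurs ?Wp //=; lia.
Qed.

Lemma count_positions_factor (P : pred (nat * nat)) T W : W != [::] ->
  count (fun o => P o && (factor T o.1 o.2 == W)) (positions T) =
  count (fun p => P (p.+1, p + size W)) (occurrences T W).
Proof.
move=> W_n0; rewrite -count_filter.
suff /permP-> : perm_eq [seq o <- positions T | factor T o.1 o.2 == W]
    [seq (p.+1, p + size W) | p <- occurrences T W] by rewrite count_map.
apply: uniq_perm.
- exact/filter_uniq/uniq_positions.
- by rewrite map_inj_uniq ?uniq_occurrences // => p q [].
move=> [s e]; rewrite mem_filter mem_positions /=.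
apply/andP/mapP => [[eqW se]|[p]].
  move: eqW; rewrite factor_eq_occurs // => /andP[Ws /eqP eE].
  by exists s.-1; rewrite ?mem_occurrences // -eE prednK //; case/andP: se.
rewrite mem_occurrences // => Wp [-> ->]; rewrite factor_occurs //; split=> //.
by have := occurs_size W_n0 Wp; rewrite -size_eq0 in W_n0; lia.
Qed.

Lemma frequencyE T W : W != [::] -> frequency T W = size (occurrences T W).
Proof. by move=> W_n0; rewrite -count_predT -(count_positions_factor predT). Qed.

Lemma net_frequencyE T W : W != [::] ->
  net_frequency T W =
  count (fun p => net_occurrence T p.+1 (p + size W)) (occurrences T W).
Proof. exact: (count_positions_factor (fun o => net_occurrence T o.1 o.2)). Qed.

Lemma frequency_rcons T W x : W != [::] ->
  frequency T (rcons W x) =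
  count (fun r => onth T (r + size W) == Some x) (occurrences T W).
Proof.
move=> W_n0; rewrite frequencyE -?size_eq0 ?size_rcons // -size_filter -filter_predI.
by congr size; apply: eq_filter => r; rewrite occurs_rcons andbC.
Qed.

Lemma frequency_cons T W x : W != [::] ->
  frequency T (x :: W) =
  count (fun r => (0 < r) && (onth T r.-1 == Some x)) (occurrences T W).
Proof.
move=> W_n0; rewrite frequencyE // -size_filter -(size_map succn).
apply/perm_size/uniq_perm; rewrite ?(map_inj_uniq succn_inj) ?uniq_occurrences //.
  exact/filter_uniq/uniq_occurrences.
move=> r; rewrite mem_filter mem_occurrences //.
apply/mapP/idP => [[p]|]; first by rewrite mem_occurrences // occurs_cons => ? ->.
by case: r => // p; exists p; rewrite ?mem_occurrences ?occurs_cons.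
Qed.

Lemma net_occurrenceE T W p : W != [::] -> occurs T W p ->
  net_occurrence T p.+1 (p + size W) =
  [&& 2 <= size (occurrences T W),
      (p == 0) || (count (fun r => (0 < r) && (onth T r.-1 == onth T p.-1))
                     (occurrences T W) == 1) &
      (p + size W == size T) ||
        (count (fun r => onth T (r + size W) == onth T (p + size W))
           (occurrences T W) == 1)].
Proof.
move=> W_n0 Wp; have pW := occurs_size W_n0 Wp.
have W_gt0 : 0 < size W by rewrite lt0n size_eq0.
rewrite /net_occurrence /= factor_occurs // frequencyE // pW.
have -> /= : p < p + size W by lia.
congr [&& _, _ & _]; rewrite ?eqSS.
  case: p Wp pW => //= p Wp pW.
  case Tp: (onth T p) (onthTE T p) => [x|] /= ltpT; last by lia.
  have xWp : occurs T (x :: W) p by rewrite occurs_cons Tp eqxx.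
  by rewrite addSnnS (@factor_occurs _ (x :: W)) // frequency_cons.
have [//|neq_end] := eqVneq (p + size W).
case Tp: (onth T (p + size W)) (onthTE T (p + size W)) => [x|] /= ltpT; last by lia.
have Wxp : occurs T (rcons W x) p by rewrite occurs_rcons Wp Tp /=.
have := @factor_occurs T (rcons W x) p.
by rewrite size_rcons addnS => ->; rewrite ?frequency_rcons // -size_eq0 size_rcons.
Qed.

Lemma net_frequency_two_occurrences T W q : W != [::] -> 0 < q ->
  occurrences T W =i [:: 0; q] -> onth T (size W) != onth T (q + size W) ->
  net_frequency T W = 2.
Proof.
move=> W_n0 q_gt0 occW neq_right.
have perm_occ : perm_eq (occurrences T W) [:: 0; q].
  by apply: uniq_perm => //; rewrite ?uniq_occurrences //= inE andbT neq_ltn q_gt0.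
have [W0 Wq] : occurs T W 0 /\ occurs T W q.
  by rewrite -!mem_occurrences // !occW !inE !eqxx orbT.
rewrite net_frequencyE // (permP perm_occ) /= !net_occurrenceE //.
rewrite !(permP perm_occ) (perm_size perm_occ) /= !add0n q_gt0 !eqxx.
by rewrite (eq_sym (onth T (q + _))) (negPf neq_right) !orbT.
Qed.

End Occurrences.

Section Primitive.

Variable A : eqType.
Implicit Types (u v w : seq A) (P : pred A).

Definition power w n : seq A := flatten (nseq n w).

Definition primitive w : Prop :=
  w != [::] /\ forall p, 0 < p < size w -> rot p w != w.

Lemma powerS w n : power w n.+1 = w ++ power w n.
Proof. by []. Qed.

Lemma size_power w n : size (power w n) = n * size w.
Proof. by rewrite size_flatten /shape map_nseq sumn_nseq mulnC. Qed.

Lemma count_power P w n : count P (power w n) = n * count P w.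
Proof. by rewrite count_flatten map_nseq sumn_nseq mulnC. Qed.

Lemma power_cat_comm u v n : u ++ v = v ++ u -> power u n ++ v = v ++ power u n.
Proof.
move=> uv; elim: n => [|n IHn]; first by rewrite cats0.
by rewrite powerS -catA IHn !catA uv.
Qed.

Lemma commuting_powers u v : u ++ v = v ++ u -> power u (size v) = power v (size u).
Proof.
move=> uv; have/esym uvn := power_cat_comm (size v) uv.
have/eqP := power_cat_comm (size u) uvn.
by rewrite eqseq_cat ?size_power 1?mulnC // => /andP[/eqP].
Qed.

Lemma coprime_count_primitive P w : coprime (size w) (count P w) -> primitive w.
Proof.
move=> co_w; split=> [|p p_w]; first by apply: contraTneq co_w => ->.
apply/eqP => rot_w.
have /commuting_powers/(congr1 (count P)) :
  take p w ++ drop p w = drop p w ++ take p w by rewrite cat_take_drop.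
rewrite !count_power size_drop size_takel; last by lia.
move=> proportional.
have: size w %| p * count P w.
  apply/dvdnP; exists (count P (take p w)).
  have := count_cat P (take p w) (drop p w); rewrite cat_take_drop => ->.
  by rewrite mulnDr -proportional -mulnDl mulnC; congr (_ * _); lia.
by rewrite Gauss_dvdl // => /dvdn_leq; lia.
Qed.

Lemma primitive_occurs_power w n p :
  primitive w -> occurs (power w n) w p -> size w %| p.
Proof.
move=> [w_n0 w_rot]; rewrite /occurs; elim: n p => [|n IHn] p.
  by rewrite drop_oversize // prefixs0 (negPf w_n0).
rewrite powerS drop_cat; case: ltnP => [pw|wp]; last first.
  by rewrite -[in X in _ -> X](subnK wp) dvdn_addl //; apply: IHn.
have [-> //|p_gt0] := posnP p.
case: n {IHn} => [/size_prefix|n]; first by rewrite cats0 size_drop; lia.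
rewrite powerS prefixE take_cat size_drop ltnNge leq_subr /= subKn 1?ltnW //.
by rewrite takel_cat 1?ltnW // (negPf (w_rot p _)) ?p_gt0.
Qed.

Lemma prefix_power w u : w != [::] -> prefix u (w ++ u) -> prefix u (power w (size u)).
Proof.
move=> w_n0 u_wu.
have u_pow n : prefix u (power w n ++ u).
  elim: n => [|n IHn]; first exact: prefix_refl.
  by apply: prefix_trans u_wu _; rewrite powerS -catA prefix_catr // eqxx.
have := u_pow (size u); rewrite !prefixE takel_cat //.
by rewrite size_power leq_pmulr // lt0n size_eq0.
Qed.

Lemma primitive_occurs_cat w u p :
  primitive w -> prefix u (w ++ u) -> occurs (w ++ u) w p -> size w %| p.
Proof.
move=> w_prim u_wu wp; have [w_n0 _] := w_prim.
have /prefixP[t powE] : prefix (w ++ u) (power w (size u).+1).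
  by rewrite powerS prefix_catr // eqxx prefix_power.
apply: (primitive_occurs_power (n := (size u).+1) w_prim).
by rewrite powE occurs_catl // occurs_size.
Qed.

End Primitive.

Section NearCommuting.

Variable A : eqType.
Implicit Types (u v w : seq A) (x y : A).

Lemma occurrences_near_commuting w v u x y :
  w ++ v = u ++ [:: x; y] -> v ++ w = u ++ [:: y; x] ->
  primitive w -> 2 < size w -> 3 < size v ->
  occurrences (w ++ v ++ w) u =i [:: 0; size w].
Proof.
move=> wvE vwE w_prim w_gt2 v_gt3 p.
have sizeE : size w + size v = size u + 2.
  by have := congr1 size wvE; rewrite !size_cat.
have u_n0 : u != [::] by rewrite -size_eq0; lia.
have TE : w ++ v ++ w = (w ++ u) ++ [:: y; x] by rewrite vwE catA.
have w_u : prefix w u.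
  by have := prefix_prefix w v; rewrite wvE !prefixE takel_cat //; lia.
have u_wu : prefix u (w ++ u).
  have := prefix_prefix u ([:: x; y] ++ w); rewrite catA -wvE -catA TE.
  by rewrite !prefixE takel_cat // size_cat leq_addl.
rewrite mem_occurrences // !inE; apply/idP/orP => [up|[]/eqP->].
- have p_le : p <= size w + 2.
    by have := occurs_size u_n0 up; rewrite TE !size_cat /=; lia.
  have wp : occurs (w ++ u) w p.
    rewrite -(occurs_catl [:: y; x]) -?TE; last by rewrite size_cat; lia.
    exact: prefix_trans w_u up.
  have /dvdnP[[|[|k]] pE] := primitive_occurs_cat w_prim u_wu wp;
    [left|right|]; rewrite pE.
  + by [].
  + by rewrite mul1n.
  + by move: p_le; rewrite pE !mulSn; lia.
- by rewrite TE /occurs drop0 prefix_catl.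
- by rewrite TE -catA /occurs drop_size_cat // prefix_prefix.
Qed.

Lemma net_frequency_near_commuting w v u x y : x != y ->
  w ++ v = u ++ [:: x; y] -> v ++ w = u ++ [:: y; x] ->
  primitive w -> 2 < size w -> 3 < size v ->
  net_frequency (w ++ v ++ w) u = 2.
Proof.
move=> xy wvE vwE w_prim w_gt2 v_gt3.
have occ_u := occurrences_near_commuting wvE vwE w_prim w_gt2 v_gt3.
apply: (net_frequency_two_occurrences _ _ occ_u); last 1 first.
- have -> : onth (w ++ v ++ w) (size u) = Some x.
    by rewrite catA wvE -catA onth_cat ltnn subnn.
  have -> : onth (w ++ v ++ w) (size w + size u) = Some y.
    by rewrite vwE onth_cat ltnNge leq_addr addKn onth_cat ltnn subnn.
  by [].
- by have := congr1 size wvE; rewrite -size_eq0 !size_cat /=; lia.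
- by lia.
Qed.

End NearCommuting.

Lemma fibwordS k : 0 < k -> fibword k.+2 = fibword k.+1 ++ fibword k.
Proof. by case: k. Qed.

Lemma fiblenS k : 0 < k -> fiblen k.+2 = fiblen k.+1 + fiblen k.
Proof. by move=> k_gt0; rewrite /fiblen fibwordS // size_cat. Qed.

Lemma fibword_near_commute k : 0 < k -> exists u x y,
  [/\ x != y, fibword k.+1 ++ fibword k = u ++ [:: x; y]
    & fibword k ++ fibword k.+1 = u ++ [:: y; x]].
Proof.
elim: k => // -[|k] IHk _; first by exists [::], La, Lb.
have [//|u [x [y [xy wvE vwE]]]] := IHk.
exists (fibword k.+2 ++ u), y, x.
by rewrite eq_sym fibwordS // -!catA wvE vwE.
Qed.

Lemma count_La_fibword k : 0 < k -> count_mem La (fibword k.+1) = fiblen k.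
Proof.
elim/ltn_ind: k => -[|[|[|k]]] IHk // _.
by rewrite fibwordS // count_cat !IHk // (@fiblenS k.+1).
Qed.

Lemma coprime_fiblenS k : 0 < k -> coprime (fiblen k.+1) (fiblen k).
Proof.
elim: k => // -[|k] IHk _ //.
by rewrite fiblenS // coprime_sym /coprime gcdnDl; apply: IHk.
Qed.

Lemma primitive_fibword k : 0 < k -> primitive (fibword k.+1).
Proof.
move=> k_gt0; apply: (@coprime_count_primitive _ (pred1 La)).
by rewrite count_La_fibword // coprime_fiblenS.
Qed.

Lemma leq_pred_fiblen k : k.-1 <= fiblen k.
Proof.
elim/ltn_ind: k => -[|[|[|[|k]]]] // IHk; rewrite fiblenS //.
by have := IHk k.+3; have := IHk k.+2; lia.
Qed.

Theorem theorem11 (i : nat) (hi : 7 <= i) :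
  2 <= net_frequency (fibword i) (factor (fibword i.-1) 1 (fiblen i.-1 - 2)).
Proof.
(* [F_4] is too short for [net_frequency_near_commuting], so [i = 7] is computed. *)
move: hi; rewrite leq_eqVlt => /predU1P[<- //|].
case: i => [|[|[|k]]] // k_gt4; have k_gt0 : 0 < k by lia.
have [u [x [y [xy wvE vwE]]]] := fibword_near_commute k_gt0.
have -> : factor (fibword k.+2) 1 (fiblen k.+2 - 2) = u.
  by rewrite /factor drop0 /fiblen fibwordS // wvE size_cat addnK take_size_cat.
rewrite fibwordS // fibwordS // -catA.
rewrite (net_frequency_near_commuting xy wvE vwE) //.
- exact: primitive_fibword.
- by apply: leq_trans (leq_pred_fiblen k.+1); lia.
- by apply: leq_trans (leq_pred_fiblen k); lia.
Qed.
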